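(* Fix constants $\sigma>0$, $A>2\sqrt2$, $\alpha>1$, fix one of the two estimators (Lasso or Dantzig), and set $c_0=3$ for the Lasso and $c_0=1$ for the Dantzig estimator. Let $$c_2=\frac32\left(1+\frac{(1+c_0)^2}{(1+2c_0)(\alpha-1)}\right)$$ and fix a constant $c_1>2c_2$. For each $n\ge 1$ let $M=M_n\ge2$ and $s=s_n\ge1$ be integers, $X=X^{(n)}$ a deterministic $n\times M$ real matrix, $\theta^*=\theta^{*,(n)}\in\mathbb{R}^M$, and $Y=X\theta^*+W$ with $W=(W_1,\dots,W_n)^T$. Put $r=r_n=A\sigma\sqrt{(\log M)/n}$. Assume that for all $n$ large enough: (i) $W_1,\dots,W_n$ are i.i.d. $\mathcal{N}(0,\sigma^2)$; (ii) the Gram matrix $\Psi=\frac1nX^TX$ satisfies $\Psi_{j,j}=1$ for all $1\le j\le M$ and $\max_{i\ne j}|\Psi_{i,j}|\le\frac{1}{\alpha(1+2c_0)s}$; (iii) $M(\theta^* )\le s$; (iv) $|\theta^*_j|>c_1r$ for every $j\in J(\theta^* )$. Assume moreover that $M\to\infty$ and $\frac{\log M}{n}\to0$ as $n\to\infty$. Let $\hat\Theta$ be the set of all solutions of the chosen problem (Lasso or Dantzig) with tuning parameter $r$, and let $\tilde\Theta$ be the set of all thresholded estimators $\tilde\theta$ associated with elements $\hat\theta\in\hat\Theta$ with threshold $c_2r$. Then $$\mathbb{P}\left(\overrightarrow{\mathrm{sign}}(\tilde\theta)=\overrightarrow{\mathrm{sign}}(\theta^* )\ \text{ for all }\tilde\theta\in\tilde\Theta\right)\to1\quad\text{as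 } n\to\infty.$$
   Context: For $z\in\mathbb{R}^d$, $|z|_p=(\sum_j|z_j|^p)^{1/p}$ for $1\le p<\infty$ and $|z|_\infty=\max_j|z_j|$. For $\theta\in\mathbb{R}^M$, $J(\theta)=\{j:\theta_j\ne0\}$ and $M(\theta)=|J(\theta)|$. For $r>0$, the Lasso solution set is the set of all minimizers over $\theta\in\mathbb{R}^M$ of $\frac1n|Y-X\theta|_2^2+2r|\theta|_1$. The Dantzig solution set is the set of all minimizers of $|\theta|_1$ over those $\theta\in\mathbb{R}^M$ satisfying $\left|\frac1nX^T(Y-X\theta)\right|_\infty\le r$. For $\hat\theta\in\hat\Theta$, the associated thresholded estimator $\tilde\theta\in\mathbb{R}^M$ with threshold $c_2r$ is defined by $\tilde\theta_j=\hat\theta_j$ if $|\hat\theta_j|>c_2r$ and $\tilde\theta_j=0$ otherwise. The sign vector is $\overrightarrow{\mathrm{sign}}(\theta)=(\mathrm{sign}(\theta_1),\dots,\mathrm{sign}(\theta_M))^T$, with $\mathrm{sign}(t)=1$ if $t>0$, $0$ if $t=0$, $-1$ if $t<0$. All of $M$, $s$, $X$, $\theta^*$, $\hat\Theta$ may vary with $n$. *)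

(* Defs.v *)
From HB Require Import structures.
From mathcomp Require Import all_boot all_order all_algebra.
From mathcomp Require Import all_classical all_reals all_analysis.

Set Implicit Arguments.
Unset Strict Implicit.
Unset Printing Implicit Defensive.

Import Order.TTheory GRing.Theory Num.Theory.
Import numFieldNormedType.Exports.

Local Open Scope classical_set_scope.
Local Open Scope ring_scope.

(* [lpnorm p z] is meant for 1 <= p < oo; the sup norm |z|_oo is the
   library's [mx_norm z], which on a column vector is max_j |z_j|. *)
Definition lpnorm (R : realType) (m : nat) (p : R) (z : 'cV[R]_m) : R :=
  (\sum_(j < m) `|z j 0| `^ p) `^ p^-1.

Definition supp (R : realType) (m : nat) (theta : 'cV[R]_m) : {set 'I_m} :=
  [set j | theta j 0 != 0]%SET.

Definition minimizers (R : realType) (V : Type) (D : set V) (f : V -> R) :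
    set V :=
  [set x | D x /\ forall y, D y -> f x <= f y].

Inductive estimator := Lasso | Dantzig.

Definition solutions (R : realType) (e : estimator) (n m : nat)
    (X : 'M[R]_(n, m)) (Y : 'cV[R]_n) (r : R) : set 'cV[R]_m :=
  match e with
  | Lasso =>
      minimizers setT (fun theta =>
        n%:R^-1 * lpnorm 2 (Y - X *m theta) ^+ 2 + 2 * r * lpnorm 1 theta)
  | Dantzig =>
      minimizers
        [set theta | mx_norm (n%:R^-1 *: (X^T *m (Y - X *m theta))) <= r]
        (lpnorm 1)
  end.

Definition threshold (R : realType) (m : nat) (t : R) (theta : 'cV[R]_m) :
    'cV[R]_m :=
  \col_j (if t < `|theta j 0| then theta j 0 else 0).

Definition sign_vec (R : realType) (m : nat) (theta : 'cV[R]_m) : 'cV[R]_m :=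
  map_mx Num.sg theta.

Definition gram (R : realType) (n m : nat) (X : 'M[R]_(n, m)) : 'M[R]_m :=
  n%:R^-1 *: (X^T *m X).

Definition c0 (R : realType) (e : estimator) : R :=
  match e with Lasso => 3 | Dantzig => 1 end.

Definition c2 (R : realType) (e : estimator) (alpha : R) : R :=
  3 / 2 * (1 + (1 + c0 R e) ^+ 2 / ((1 + 2 * c0 R e) * (alpha - 1))).

Definition tuning (R : realType) (A sigma : R) (n m : nat) : R :=
  A * sigma * Num.sqrt (ln m%:R / n%:R).

Definition independent_RVs (d : measure_display) (T : measurableType d)
    (R : realType) (P : probability T R) (I : finType)
    (Z : I -> {RV P >-> R}) : Prop :=
  forall (J : {set I}) (B : I -> set R), (forall i, measurable (B i)) ->
    P (\bigcap_(i in [set` J]) (Z i @^-1` B i)) =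
    (\prod_(i in J) P (Z i @^-1` B i))%E.

(* [normal_prob m s] is parameterized by the standard deviation s. *)
Definition iid_centered_normal (d : measure_display) (T : measurableType d)
    (R : realType) (P : probability T R) (I : finType) (sigma : R)
    (Z : I -> {RV P >-> R}) : Prop :=
  independent_RVs Z /\
  forall (i : I) (B : set R), measurable B ->
    distribution P (Z i) B = normal_prob 0 sigma B.

(* Main.v *)
(* On the event [|X^T W / n|_oo <= r / 2] both estimators satisfy
   [|X^T (Y - X theta) / n|_oo <= r] and, with [Delta = theta - theta_star], the
   cone condition [|Delta_{J^c}|_1 <= c_0 |Delta_J|_1]; hence
   [|Psi Delta|_oo <= 3 r / 2], and the small coherence of [Psi] upgrades this to
   [|Delta|_oo <= c_2 r], which is less than half the smallest nonzero
   [|theta_star_j|].  Chernoff's bound for Gaussian sums and a union bound give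
   the complementary event probability at most [2 M ^ (1 - A^2 / 8)].

   The recovery event also has to be shown measurable, because a probability
   takes arbitrary values on nonmeasurable sets. *)
Require Import Defs.
From HB Require Import structures.
From mathcomp Require Import all_boot all_order all_algebra.
From mathcomp Require Import all_classical all_reals all_analysis.
From mathcomp Require Import measurable_realfun ring lra.

Set Implicit Arguments.
Unset Strict Implicit.
Unset Printing Implicit Defensive.

Import Order.TTheory GRing.Theory Num.Theory.
Import numFieldNormedType.Exports.
Import HBNNSimple.

Local Open Scope classical_set_scope.
Local Open Scope ring_scope.

(** * Gaussian sums *)

(** [nu] is the image under [phi] of the measure with density [g]. The formula holds for indicators
    by hypothesis, passes to simple functions by linearity and to [f] by monotone convergence. It
    serves both for peeling off one independent variable and for the Gaussian density. *)
Lemma ge0_integral_density d d' (T : measurableType d) (T' : measurableType d')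
    (R : realType) (mu : {measure set T -> \bar R})
    (nu : {measure set T' -> \bar R}) (phi : T -> T') (g : T -> R)
    (f : T' -> \bar R) :
  measurable_fun setT phi -> measurable_fun setT g -> (forall x, 0 <= g x) ->
  (forall B, measurable B ->
    nu B = (\int[mu]_(x in phi @^-1` B) (g x)%:E)%E) ->
  measurable_fun setT f -> (forall y, (0 <= f y)%E) ->
  (\int[nu]_y f y = \int[mu]_x (f (phi x) * (g x)%:E))%E.
Proof.
move=> mphi mg g0 nuE mf f0.
have mphiT B : measurable B -> measurable (phi @^-1` B).
  by move=> mB; rewrite -[X in measurable X]setTI; exact: mphi.
pose h := nnsfun_approx measurableT mf.
have hf y : EFin (h n y) @[n --> \oo] --> f y by exact: cvg_nnsfun_approx.
have mh n : measurable_fun setT (EFin \o h n).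
  by apply/measurable_EFinP; exact: measurable_funP.
have ndh y : {homo (fun n => h n y) : a b / (a <= b)%N >-> a <= b}.
  by move=> a b ab; exact/lefP/nd_nnsfun_approx.
have -> : (\int[nu]_y f y =
    limn (fun n => \int[nu]_y (EFin \o h n) y))%E.
  rewrite -monotone_convergence//.
  - by apply: eq_integral => y _; apply/esym/cvg_lim => //; exact: hf.
  - by move=> n y _; rewrite /= lee_fin.
  - by move=> y _ a b ab /=; rewrite lee_fin ndh.
have -> : (\int[mu]_x (f (phi x) * (g x)%:E) =
    limn (fun n => \int[mu]_x ((h n (phi x))%:E * (g x)%:E)))%E.
  rewrite -monotone_convergence//.
  - apply: eq_integral => x _; apply/esym/cvg_lim => //.
    by apply: cvgeZr => //; exact: hf.
  - move=> n; apply/measurable_EFinP/measurable_funM => //.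
    exact: measurableT_comp.
  - by move=> n x _; rewrite -EFinM lee_fin mulr_ge0.
  - by move=> x _ a b ab; rewrite -!EFinM lee_fin ler_wpM2r// ndh.
congr (limn _); apply/funext => n.
have m1 y : measurable_fun setT (\1_(h n @^-1` [set y]) : T' -> R).
  exact: measurable_indic.
transitivity (\sum_(y \in range (h n))
    \int[nu]_z (y * \1_(h n @^-1` [set y]) z)%:E)%E.
  rewrite -ge0_integral_fsum//.
  - by apply: eq_integral => z _; rewrite /= [in LHS]fimfunE -fsumEFin.
  - by move=> y; apply/measurable_EFinP/measurable_funM.
  - by move=> y z _; rewrite nnfun_muleindic_ge0.
transitivity (\sum_(y \in range (h n))
    \int[mu]_x ((y * \1_(h n @^-1` [set y]) (phi x))%:E * (g x)%:E))%E; last first.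
  rewrite -ge0_integral_fsum//.
  - apply: eq_integral => x _; rewrite [in RHS]fimfunE -fsumEFin//.
    rewrite ge0_mule_fsuml// => y; exact: nnfun_muleindic_ge0.
  - move=> y; apply/measurable_EFinP/measurable_funM => //.
    by apply: measurable_funM => //; exact: measurableT_comp.
  - move=> y x _; apply: mule_ge0; last by rewrite lee_fin.
    exact: nnfun_muleindic_ge0.
apply: eq_fsbigr => y; rewrite inE/= => -[z _ yE].
(* Being a value of the nonnegative simple function [h n], [y] is nonnegative, so it can be pulled
   out of the integral. *)
have y0 : 0 <= y by rewrite -yE.
under eq_integral do rewrite EFinM.
rewrite integralZl_indic_nnsfun// integral_indic// setIT nuE//.
under [RHS]eq_integral do rewrite EFinM -muleA.
rewrite [RHS]ge0_integralZl//.
- congr (_ * _)%E; rewrite integral_mkcond; apply: eq_integral => x _.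
  rewrite epatch_indic /= muleC; congr (_ * _)%E.
- apply: emeasurable_funM; last exact/measurable_EFinP.
  by apply/measurable_EFinP; exact: measurableT_comp.
- by move=> x _; rewrite mule_ge0// lee_fin.
Qed.

(* The factors are turned from indicators into arbitrary functions one index at
   a time; each step is an instance of [ge0_integral_density] in that variable. *)
Lemma expectation_prod_indep d (T : measurableType d) (R : realType)
    (P : probability T R) (I : finType) (Z : I -> {RV P >-> R})
    (f : I -> R -> R) (c : I -> R) :
  independent_RVs Z -> (forall i, measurable_fun setT (f i)) ->
  (forall i x, 0 <= f i x) ->
  (forall i, \int[P]_w (f i (Z i w))%:E = (c i)%:E)%E ->
  (\int[P]_w (\prod_i f i (Z i w))%:E = (\prod_i c i)%:E)%E.
Proof.
move=> indep.
have mZ i B : measurable B -> measurable (Z i @^-1` B).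
  by move=> mB; rewrite -[X in measurable X]setTI; exact: measurable_funP.
suff main n : forall (J : {set I}) (f : I -> R -> R) (c : I -> R), (#|J| <= n)%N ->
    (forall i, measurable_fun setT (f i)) -> (forall i x, 0 <= f i x) ->
    (forall i, i \notin J -> exists2 B, measurable B & f i = \1_B) ->
    (forall i, \int[P]_w (f i (Z i w))%:E = (c i)%:E)%E ->
    (\int[P]_w (\prod_i f i (Z i w))%:E = (\prod_i c i)%:E)%E.
  move=> mf f0 cE; apply: (main #|I| [set: I]%SET) => //; first exact: max_card.
  by move=> i; rewrite finset.inE.
elim: n => [|n IH] {f c} J f c.
  (* With all factors indicators, the claim is independence itself. *)
  rewrite leqn0 cards_eq0 => /eqP -> mf f0 fB cE.
  have /choice [B /all_and2 [mB fE]] i : exists B, measurable B /\ f i = \1_B.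
    by have [|B] := fB i; [rewrite finset.inE|exists B].
  have := indep [set: I]%SET B mB.
  move=> PE; transitivity (P (\bigcap_(i in [set` [set: I]%SET]) Z i @^-1` B i)).
    rewrite -[in RHS](setIT (\bigcap_(i in _) _)) -integral_indic//; last first.
      apply: fin_bigcap_measurable; last by move=> i _; exact: mZ.
      exact: finite_finset.
    apply: eq_integral => w _; congr EFin; rewrite indicE.
    have [/set_mem wB|] := boolP (w \in _).
      rewrite big1// => i _; rewrite fE indicE mem_set//.
      by apply: wB; rewrite /= finset.inE.
    rewrite notin_setE => /existsNP[i] /not_implyP[_ wB].
    rewrite mulr0n; apply/eqP/prodf_eq0; exists i => //.
    by rewrite fE indicE memNset.
  rewrite PE -prodEFin; apply: eq_big => i; first by rewrite finset.inE.
  move=> _.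
  rewrite -cE fE -[in LHS](setIT (Z i @^-1` B i)) -integral_indic//.
  exact: mZ.
move=> Jn mf f0 fB cE.
have [J0|[k kJ]] := set_0Vmem J.
  by apply: (IH J) => //; rewrite J0 cards0.
have c0 i : 0 <= c i.
  by rewrite -lee_fin -cE; apply: integral_ge0 => w _; rewrite lee_fin.
have pc0 : 0 <= \prod_(i | i != k) c i by apply: prodr_ge0.
pose g w := \prod_(i | i != k) f i (Z i w).
have mg : measurable_fun setT g.
  rewrite /g; under eq_fun do rewrite -big_filter.
  apply: measurable_prod => i _.
  by apply: measurableT_comp => //.
have g0 w : 0 <= g w by apply: prodr_ge0.
(* The law of [Z k] weighted by the product of the other means. That [nu B] is the integral of [g]
   over the event [Z k] in [B] is the induction hypothesis with [f k] replaced by the indicator of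
   [B]. *)
pose nu := mscale (NngNum pc0) (distribution P (Z k)).
have fEg w : (\prod_i f i (Z i w))%:E = ((f k (Z k w))%:E * (g w)%:E)%E.
  by rewrite (bigD1 k)//= -EFinM.
transitivity (\int[nu]_y (f k y)%:E)%E; last first.
  rewrite ge0_integral_mscale//=.
  - rewrite ge0_integral_distribution//; last 2 first.
      exact/measurable_EFinP.
    by move=> y; rewrite lee_fin.
    by rewrite cE -EFinM mulrC [in RHS](bigD1 k).
  - exact/measurable_EFinP.
  - by move=> y _; rewrite lee_fin.
rewrite (@ge0_integral_density _ _ _ _ R P _ (Z k) g)//.
- by apply: eq_integral => w _; exact: fEg.
- move=> B mB.
  pose f' i := if i == k then \1_B : R -> R else f i.
  pose c' i := if i == k then fine (P (Z k @^-1` B)) else c i.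
  have f'k i : i != k -> f' i = f i by rewrite /f' => /negbTE ->.
  have E : (\int[P]_w (\prod_i f' i (Z i w))%:E = (\prod_i c' i)%:E)%E.
    apply: (IH (J :\ k)%SET).
    + by move: Jn; rewrite (cardsD1 k) kJ.
    + by move=> i; rewrite /f'; case: ifP => // _; exact: measurable_indic.
    + by move=> i x; rewrite /f'; case: ifP => // _; rewrite indicE.
    + move=> i; rewrite finset.in_setD1 /f'; case: eqVneq => //= _; last exact: fB.
      by exists B.
    + move=> i; rewrite /c'; case: ifPn => [/eqP ->|ik]; last by rewrite f'k.
      rewrite /f' eqxx fineK; last by rewrite fin_num_measure//; exact: mZ.
      by rewrite -[in RHS](setIT (Z k @^-1` B)) -integral_indic//; exact: mZ.
  transitivity (\prod_i c' i)%:E.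
    rewrite [in RHS](bigD1 k)//= /c' eqxx EFinM fineK; last first.
      by rewrite fin_num_measure//; exact: mZ.
    rewrite muleC; congr (_%:E * _)%E.
    by apply: eq_bigr => i /negbTE ->.
  rewrite -E [RHS]integral_mkcond; apply: eq_integral => w _.
  rewrite epatch_indic /= muleC (bigD1 k)//= EFinM; congr (_ * _)%E.
    by rewrite /f' eqxx.
  by congr EFin; apply: eq_bigr => i ik; rewrite f'k.
- exact/measurable_EFinP.
- by move=> y; rewrite lee_fin.
Qed.

(** Completing the square turns exp(a x) times the centered density into exp(a^2 s^2 / 2) times the
    normal density with mean a s^2, which integrates to 1. *)
Lemma normal_mgf (R : realType) (s a : R) (nu : {measure set R -> \bar R}) :
  s != 0 -> (forall B, measurable B -> nu B = normal_prob 0 s B) ->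
  (\int[nu]_x (expR (a * x))%:E = (expR (a ^+ 2 * s ^+ 2 / 2))%:E)%E.
Proof.
move=> s0 nuE.
have mpdf m : measurable_fun setT (normal_pdf m s) by exact: measurable_normal_pdf.
have me : measurable_fun setT (fun x : R => (expR (a * x))%:E).
  apply/measurable_EFinP; apply: (measurableT_comp (@measurable_expR R)).
  exact: measurable_funM.
(* The identity map relates the measurable structure of [lebesgue_measure] to the
   default one on [R]; they have the same sets but different displays. *)
rewrite (@ge0_integral_density _ _ _ _ R lebesgue_measure nu
  (fun x : R => x : R) (normal_pdf 0 s))//.
- transitivity (\int[lebesgue_measure]_x
      ((expR (a ^+ 2 * s ^+ 2 / 2))%:E * (normal_pdf (a * s ^+ 2) s x)%:E))%E.
    apply: eq_integral => x _; rewrite -!EFinM; congr EFin.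
    rewrite !normal_pdfE//= /normal_fun mulrCA [RHS]mulrCA.
    rewrite -!expRD; congr (_ * expR _); field.
    by rewrite s0.
  rewrite ge0_integralZl//.
  + by rewrite integral_normal_pdf mule1.
  + by apply/measurable_EFinP; exact: mpdf.
  + by move=> x _; rewrite lee_fin normal_pdf_ge0.
- exact: mpdf.
- by move=> x; exact: normal_pdf_ge0.
Qed.

Lemma measurable_set_le d (T : measurableType d) (R : realType) (f g : T -> R) :
  measurable_fun setT f -> measurable_fun setT g ->
  measurable [set x | f x <= g x].
Proof. by move=> mf mg; rewrite -[X in measurable X]setTI; exact: measurable_fun_le. Qed.

Section gaussian_sum.
Context d (T : measurableType d) (R : realType) (P : probability T R)
  (I : finType) (s : R) (Z : I -> {RV P >-> R}).
Hypotheses (s_neq0 : s != 0) (iidZ : iid_centered_normal s Z).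

Lemma gaussian_sum_mgf (a : I -> R) :
  (\int[P]_w (expR (\sum_i a i * Z i w))%:E =
   (expR (s ^+ 2 / 2 * \sum_i a i ^+ 2))%:E)%E.
Proof.
have [indep law] := iidZ.
under eq_integral do rewrite expR_sum.
have me i : measurable_fun setT (fun x : R => expR (a i * x)).
  by apply: (measurableT_comp (@measurable_expR R)); exact: measurable_funM.
rewrite (@expectation_prod_indep _ _ _ _ _ Z (fun i x => expR (a i * x))
  (fun i => expR (a i ^+ 2 * s ^+ 2 / 2)) indep)//.
- rewrite -expR_sum mulr_sumr; congr (expR _)%:E.
  by apply: eq_bigr => i _; ring.
move=> i.
transitivity (\int[distribution P (Z i)]_y (expR (a i * y))%:E)%E.
  rewrite ge0_integral_distribution//; first exact/measurable_EFinP.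
by apply: normal_mgf => // B; exact: law.
Qed.

Lemma measurable_gaussian_sum (a : I -> R) :
  measurable_fun setT (fun w => \sum_i a i * Z i w).
Proof.
by apply: measurable_sum => i; apply: measurable_funM => //; exact: measurable_funP.
Qed.

Lemma gaussian_sum_upper_tail (a : I -> R) (t : R) :
  0 < t -> 0 < \sum_i a i ^+ 2 ->
  (P [set w | t <= \sum_i a i * Z i w]%R
   <= (expR (- (t ^+ 2 / (2 * s ^+ 2 * \sum_i a i ^+ 2))))%:E)%E.
Proof.
set v := \sum_i a i ^+ 2 => t0 v0.
have s20 : 0 < s ^+ 2 by rewrite exprn_even_gt0.
(* The minimizer of the Chernoff exponent - u t + u^2 s^2 v / 2. *)
pose u := t / (s ^+ 2 * v).
have u0 : 0 < u by rewrite divr_gt0// mulr_gt0.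
pose A := [set w | t <= \sum_i a i * Z i w].
have mA : measurable A.
  by apply: (@measurable_set_le _ T R (cst t)) => //; exact: measurable_gaussian_sum.
rewrite -/A -[X in (P X <= _)%E](setIT A) -integral_indic//.
apply: (@le_trans _ _
  (\int[P]_w (expR (- (u * t)) * expR (\sum_i u * a i * Z i w))%:E)%E).
  apply: ge0_le_integral => //.
  - exact/measurable_EFinP.
  - apply/measurable_EFinP/measurable_funM => //.
    apply: (measurableT_comp (@measurable_expR R)).
    exact: (measurable_gaussian_sum (fun i => u * a i)).
  (* Markov's inequality in pointwise form: the indicator of [A] is at most exp(u (S - t)), with S
     the sum. *)
  - move=> w _; rewrite lee_fin indicE.
    have [/set_mem wA|_] := boolP (w \in A); last by rewrite mulr_ge0// expR_ge0.
    rewrite -expRD -[X in X <= _]expR0 ler_expR.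
    under eq_bigr do rewrite -mulrA.
    rewrite -mulr_sumr -mulrN -mulrDr mulr_ge0 ?(ltW u0)//.
    by rewrite addrC subr_ge0.
under eq_integral do rewrite EFinM.
rewrite ge0_integralZl//; last first.
- apply/measurable_EFinP; apply: (measurableT_comp (@measurable_expR R)).
  exact: (measurable_gaussian_sum (fun i => u * a i)).
rewrite gaussian_sum_mgf -EFinM -expRD lee_fin ler_expR.
under eq_bigr do rewrite exprMn.
rewrite -mulr_sumr -/v le_eqVlt; apply/orP; left; apply/eqP.
rewrite /u; field.
by rewrite gt_eqF// s_neq0.
Qed.

Lemma gaussian_sum_tail (a : I -> R) (t : R) :
  0 < t -> 0 < \sum_i a i ^+ 2 ->
  (P [set w | t <= `|\sum_i a i * Z i w|]%R
   <= (2 * expR (- (t ^+ 2 / (2 * s ^+ 2 * \sum_i a i ^+ 2))))%:E)%E.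
Proof.
move=> t0 v0.
have mS b : measurable [set w | t <= \sum_i b i * Z i w].
  by apply: (@measurable_set_le _ T R (cst t)) => //; exact: measurable_gaussian_sum.
have -> : [set w | t <= `|\sum_i a i * Z i w|] =
    [set w | t <= \sum_i a i * Z i w] `|` [set w | t <= \sum_i (- a i) * Z i w].
  apply/seteqP; split=> w /=; under [in X in _ \/ X]eq_bigr do rewrite mulNr;
    rewrite sumrN ler_normr; first by move=> /orP.
  by move=> /orP.
apply: (le_trans (measureU2 _ _ _)) => //.
rewrite mulrDl mul1r EFinD; apply: leeD; first exact: gaussian_sum_upper_tail.
have vN : \sum_i (- a i) ^+ 2 = \sum_i a i ^+ 2.
  by apply: eq_bigr => i _; rewrite sqrrN.
by rewrite -vN; apply: gaussian_sum_upper_tail; rewrite ?vN.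
Qed.

End gaussian_sum.

(** * Deterministic sup-norm error bound *)

Lemma lpnorm1E (R : realType) m (z : 'cV[R]_m) :
  lpnorm 1 z = \sum_j `|z j 0|.
Proof.
rewrite /lpnorm invr1 powRr1; last by apply: sumr_ge0 => j _; exact: powR_ge0.
by apply: eq_bigr => j _; rewrite powRr1.
Qed.

Lemma lpnorm2E (R : realType) m (z : 'cV[R]_m) :
  lpnorm 2 z ^+ 2 = \sum_j z j 0 ^+ 2.
Proof.
rewrite /lpnorm -powR_mulrn ?powR_ge0// -powRrM mulVf// powRr1; last first.
  by apply: sumr_ge0 => j _; exact: powR_ge0.
by apply: eq_bigr => j _; rewrite powR_mulrn// real_normK// num_real.
Qed.

Lemma cV_norm_le (R : realType) m (z : 'cV[R]_m) (c : R) : 0 <= c ->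
  (mx_norm z <= c) <-> (forall j, `|z j 0| <= c).
Proof.
move=> c0; rewrite mx_normrE; split => [zc j|zc].
  by apply: le_trans zc; apply: (le_bigmax _ (fun i => `|z i.1 i.2|) (j, 0)).
by apply: bigmax_le => // -[i j] _ /=; rewrite ord1.
Qed.

(* Bounding [|Delta_J|_1] by [s |Delta|_oo] instead of going through the l2
   norm and a restricted eigenvalue gives the factor
   [1 / (1 - (1 + c) / (alpha (1 + 2 c)))], which is at most the stated one. *)
Lemma coherence_sup_bound (R : realType) m (Psi : 'M[R]_m) (D : 'cV[R]_m)
    (J : {set 'I_m}) (s : nat) (c alpha K : R) :
  0 <= c -> 1 < alpha -> (0 < s)%N -> (#|J| <= s)%N ->
  (forall j, Psi j j = 1) ->
  (forall i j, i != j -> `|Psi i j| <= (alpha * (1 + 2 * c) * s%:R)^-1) ->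
  \sum_(j | j \notin J) `|D j 0| <= c * \sum_(j in J) `|D j 0| ->
  (forall j, `|(Psi *m D) j 0| <= K) ->
  forall j, `|D j 0| <= K * (1 + (1 + c) ^+ 2 / ((1 + 2 * c) * (alpha - 1))).
Proof.
move=> c0 alpha1 s0 Js diag off cone PsiD k.
(* Only the row of [Psi *m D] at a largest coordinate of [D] is needed. *)
have [j _ jmax] : exists2 j, true & forall i, `|D i 0| <= `|D j 0|.
  case: (@arg_maxP _ _ _ k predT (fun i => `|D i 0|)) => // j _ jP.
  by exists j => // i; exact: jP.
apply: le_trans (jmax k) _; set d := `|D j 0| in jmax *.
set rho := (alpha * (1 + 2 * c) * s%:R)^-1 in off.
have s0' : 0 < s%:R :> R by rewrite ltr0n.
have al0 : 0 < alpha by lra.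
have c20 : 0 < 1 + 2 * c by lra.
have rho0 : 0 <= rho by rewrite invr_ge0 ltW// !mulr_gt0.
have d0 : 0 <= d by rewrite /d.
have sumJ : \sum_(i in J) `|D i 0| <= s%:R * d.
  apply: (@le_trans _ _ (\sum_(i in J) d)); first exact: ler_sum.
  by rewrite sumr_const -[d *+ _]mulr_natl ler_wpM2r// ler_nat.
have sum1 : \sum_i `|D i 0| <= (1 + c) * (s%:R * d).
  rewrite (bigID (mem J))/=.
  apply: (@le_trans _ _ ((1 + c) * \sum_(i in J) `|D i 0|)).
    by rewrite mulrDl mul1r lerD2l.
  by rewrite ler_wpM2l// addr_ge0.
have dK : d <= K + rho * ((1 + c) * (s%:R * d)).
  have E : D j 0 = (Psi *m D) j 0 - \sum_(i | i != j) Psi j i * D i 0.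
    by rewrite mxE (bigD1 j)//= diag mul1r addrK.
  apply: (@le_trans _ _ `|(Psi *m D) j 0 - \sum_(i | i != j) Psi j i * D i 0|).
    by rewrite -E.
  apply: le_trans (ler_normB _ _) _; apply: lerD => //.
  apply: le_trans (ler_norm_sum _ _ _) _.
  apply: (@le_trans _ _ (\sum_(i | i != j) rho * `|D i 0|)).
    apply: ler_sum => i ij; rewrite normrM ler_wpM2r//.
    by apply: off; rewrite eq_sym.
  rewrite -mulr_sumr ler_wpM2l//.
  apply: le_trans sum1.
  by rewrite [leRHS](bigD1 j)//= lerDr.
have K0 : 0 <= K by apply: le_trans (PsiD k).
set B := 1 + _.
have al1 : 0 < alpha - 1 by lra.
(* Since rho s = 1 / (alpha (1 + 2 c)), multiplying [dK] by alpha (1 + 2 c) eliminates s. *)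
have dK' : d * (alpha * (1 + 2 * c) - (1 + c)) <= K * (alpha * (1 + 2 * c)).
  have -> : d * (alpha * (1 + 2 * c) - (1 + c)) =
     (d - rho * ((1 + c) * (s%:R * d))) * (alpha * (1 + 2 * c)).
    by rewrite /rho; field; rewrite !gt_eqF.
  apply: ler_wpM2r; first by rewrite mulr_ge0 ?ltW.
  by rewrite lerBlDr.
have q0 : 0 < alpha * (1 + 2 * c) - (1 + c) by nra.
rewrite -(ler_pM2r q0); apply: le_trans dK' _.
rewrite -mulrA ler_wpM2l// -subr_ge0.
(* The gap between the stated factor and the sharper one, as a quotient with visibly nonnegative
   terms. *)
have -> : B * (alpha * (1 + 2 * c) - (1 + c)) - alpha * (1 + 2 * c) =
  ((1 + 2 * c) * (alpha - 1) * (c + c ^+ 2) + c * (1 + c) ^+ 2) /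
    ((1 + 2 * c) * (alpha - 1)).
  by rewrite /B; field; rewrite !gt_eqF.
apply: divr_ge0; last by rewrite mulr_ge0// ltW.
have cc0 : 0 <= c + c ^+ 2 by rewrite addr_ge0 ?sqr_ge0.
apply: addr_ge0; last by rewrite mulr_ge0 ?sqr_ge0.
by apply: mulr_ge0 => //; apply: mulr_ge0; exact: ltW.
Qed.

(** * Optimality conditions for Lasso and Dantzig solutions under small noise *)

Section sup_error.
Context (R : realType) (n m : nat) (X : 'M[R]_(n, m)) (theta0 : 'cV[R]_m)
  (xi : 'cV[R]_n) (r : R).
Hypotheses (n_gt0 : (0 < n)%N) (r_gt0 : 0 < r)
  (gram1 : forall j, gram X j j = 1)
  (noise : forall j, `|n%:R^-1 * \sum_i X i j * xi i 0| <= r / 2).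

Let Y := X *m theta0 + xi.

Let corr (theta : 'cV[R]_m) := n%:R^-1 *: (X^T *m (Y - X *m theta)).

Lemma gramE i j : gram X i j = n%:R^-1 * \sum_k X k i * X k j.
Proof. by rewrite !mxE; congr (_ * _); apply: eq_bigr => k _; rewrite mxE. Qed.

Lemma lasso_objective_le theta theta' : solutions Lasso X Y r theta ->
  n%:R^-1 * (\sum_i (Y - X *m theta) i 0 ^+ 2) + 2 * r * \sum_j `|theta j 0|
  <= n%:R^-1 * (\sum_i (Y - X *m theta') i 0 ^+ 2) + 2 * r * \sum_j `|theta' j 0|.
Proof.
move=> [_ /(_ theta' I)] /=.
by rewrite -!lpnorm2E -!lpnorm1E.
Qed.

(** Instead of subdifferentials, coordinate j is moved by t. As the Gram diagonal is 1, the
    objective grows by at most t^2 - 2 t u + 2 r |t|, which is therefore nonnegative for every t. *)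
Lemma lasso_kkt theta : solutions Lasso X Y r theta ->
  forall j, `|corr theta j 0| <= r.
Proof.
move=> sol j; set u := corr theta j 0.
have pert t : 0 <= t ^+ 2 - 2 * t * u + 2 * r * `|t|.
  have := lasso_objective_le (theta + t *: delta_mx j 0) sol.
  have -> : \sum_i (Y - X *m (theta + t *: delta_mx j 0)) i 0 ^+ 2 =
     \sum_i (Y - X *m theta) i 0 ^+ 2
       - 2 * t * (\sum_i X i j * (Y - X *m theta) i 0)
       + t ^+ 2 * \sum_i X i j * X i j.
    rewrite !mulr_sumr -sumrB -big_split /=; apply: eq_bigr => i _.
    rewrite mulmxDr -scalemxAr -colE opprD addrA.
    rewrite [in LHS]mxE; set a := (Y - X *m theta) i 0.
    by rewrite !mxE; ring.
  have l1 : \sum_i `|(theta + t *: delta_mx j 0) i 0| <=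
      \sum_i `|theta i 0| + `|t|.
    rewrite (bigD1 j)//= [X in _ <= X + _](bigD1 j)//= addrAC lerD//.
      by rewrite !mxE !eqxx mulr1 ler_normD.
    apply: ler_sum => i /negbTE ij.
    by rewrite !mxE ij mulr0 addr0.
  have uE : u = n%:R^-1 * \sum_i X i j * (Y - X *m theta) i 0.
    rewrite /u /corr !mxE; congr (_ * _); apply: eq_bigr => i _.
    by rewrite [X^T _ _]mxE.
  have g1 := gram1 j; rewrite gramE in g1.
  rewrite uE; set S := \sum_i X i j * (Y - X *m theta) i 0.
  set Q := \sum_i X i j * X i j in g1 *.
  set L := \sum_i (Y - _) i 0 ^+ 2.
  move=> H.
  have e1 : n%:R^-1 * (L - 2 * t * S + t ^+ 2 * Q) =
    n%:R^-1 * L - 2 * t * (n%:R^-1 * S) + t ^+ 2 * (n%:R^-1 * Q) by ring.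
  rewrite e1 g1 in H.
  have l2 : 2 * r * \sum_i `|(theta + t *: delta_mx j 0) i 0| <=
      2 * r * (\sum_i `|theta i 0| + `|t|) by rewrite ler_wpM2l// mulr_ge0// ltW.
  lra.
rewrite leNgt; apply/negP => ru.
have [u0|u0] := leP 0 u.
  rewrite ger0_norm// in ru.
  (* At t = u - r the quadratic equals - (u - r)^2 < 0. The case of negative u is symmetric, with t
     = u + r. *)
  have := pert (u - r); rewrite ger0_norm; last lra.
  nra.
rewrite ltr0_norm// in ru.
have := pert (u + r); rewrite ler0_norm; last lra.
nra.
Qed.

Lemma dantzig_feasible theta :
  solutions Dantzig X Y r theta -> forall j, `|corr theta j 0| <= r.
Proof. by move=> [/cV_norm_le H _]; apply: H; exact: ltW. Qed.

Lemma residual0 : Y - X *m theta0 = xi.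
Proof. by rewrite /Y addrC addKr. Qed.

Lemma corr0 j : `|corr theta0 j 0| <= r / 2.
Proof.
rewrite /corr residual0 !mxE; under eq_bigr do rewrite mxE.
exact: noise.
Qed.

(** Off the support of [theta0] the two sides agree term by term; on it, the triangle inequality
    applies. *)
Lemma l1_diff_supp (theta : 'cV[R]_m) :
  \sum_(j | j \notin supp theta0) `|(theta - theta0) j 0|
    - \sum_(j in supp theta0) `|(theta - theta0) j 0| <=
  \sum_j `|theta j 0| - \sum_j `|theta0 j 0|.
Proof.
rewrite -sumrB [leRHS](bigID (mem (supp theta0)))/= [leRHS]addrC -sumrN lerD//.
  apply: ler_sum => j; rewrite inE negbK => /eqP j0.
  by rewrite !mxE j0 normr0 !subr0.
apply: ler_sum => j _; rewrite !mxE.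
have := ler_normD (theta0 j 0 - theta j 0) (theta j 0).
by rewrite subrK distrC; lra.
Qed.

Lemma solution_cone e theta : solutions e X Y r theta ->
  \sum_(j | j \notin supp theta0) `|(theta - theta0) j 0| <=
  c0 R e * \sum_(j in supp theta0) `|(theta - theta0) j 0|.
Proof.
have r2 : r / 2 <= r by have := r_gt0; lra.
have := l1_diff_supp theta; set D := theta - theta0.
set Jc : R := \sum_(j | _) _; set J : R := \sum_(j in _) _ => diff.
(* Dantzig: small noise makes [theta0] feasible, so |theta|_1 <= |theta0|_1, and [diff] gives the
   factor 1. *)
case: e => [sol|[_ opt]] /=; last first.
  have := opt theta0; rewrite !lpnorm1E => H.
  suff : \sum_j `|theta j 0| <= \sum_j `|theta0 j 0| by lra.
  apply: H => /=; apply/cV_norm_le; first exact: ltW.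
  by move=> j; apply: le_trans (corr0 j) r2.
(* Lasso: the objective is compared with its value at [theta0], the residual being expanded around
   [xi]. The quadratic term in [D] is dropped and the cross term is bounded by duality of the l1 and
   sup norms. *)
have := lasso_objective_le theta0 sol; rewrite residual0.
have -> : Y - X *m theta = xi - X *m D 
  by rewrite mulmxBr opprB addrA [xi + _]addrC.
have -> : \sum_i (xi - X *m D) i 0 ^+ 2 = \sum_i xi i 0 ^+ 2
    - 2 * (\sum_i xi i 0 * (X *m D) i 0) + \sum_i (X *m D) i 0 ^+ 2.
  rewrite mulr_sumr -sumrB -big_split/=; apply: eq_bigr => i _.
  by rewrite mxE [X in _ + X]mxE; ring.
have n0 : 0 < n%:R^-1 :> R by rewrite invr_gt0 ltr0n.
have cross : n%:R^-1 * (\sum_i xi i 0 * (X *m D) i 0) <= r / 2 * (J + Jc).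
  have -> : n%:R^-1 * (\sum_i xi i 0 * (X *m D) i 0) =
      \sum_j (n%:R^-1 * \sum_i X i j * xi i 0) * D j 0.
    rewrite mulr_sumr; under [RHS]eq_bigr do rewrite -mulrA mulr_suml mulr_sumr.
    rewrite exchange_big/=; apply: eq_bigr => i _.
    rewrite mxE !mulr_sumr; apply: eq_bigr => j _; ring.
  have -> : J + Jc = \sum_j `|D j 0| by rewrite [RHS](bigID (mem (supp theta0))).
  rewrite mulr_sumr; apply: ler_sum => j _.
  apply: le_trans (ler_norm _) _; rewrite normrM ler_wpM2r//.
have sq : 0 <= n%:R^-1 * \sum_i (X *m D) i 0 ^+ 2.
  by rewrite mulr_ge0 ?(ltW n0)//; apply: sumr_ge0 => i _; exact: sqr_ge0.
set N : R := \sum_i xi i 0 ^+ 2; set S : R := \sum_i xi i 0 * _ in cross *.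
set Q : R := \sum_i (X *m D) i 0 ^+ 2 in sq *.
set t1 : R := \sum_j `|theta j 0| in diff *.
set t0 : R := \sum_j `|theta0 j 0| in diff *.
have -> : n%:R^-1 * (N - 2 * S + Q) =
   n%:R^-1 * N - 2 * (n%:R^-1 * S) + n%:R^-1 * Q by ring.
move=> H.
(* With [diff] this becomes 2 (Jc - J) <= J + Jc, that is Jc <= 3 J. *)
have : r * (2 * (t1 - t0)) <= r * (J + Jc) by lra.
by rewrite ler_pM2l// => ?; lra.
Qed.

Lemma solution_sup_error e (s : nat) (alpha : R) theta :
  1 < alpha -> (0 < s)%N -> (#|supp theta0| <= s)%N ->
  (forall i j, i != j ->
    `|gram X i j| <= (alpha * (1 + 2 * c0 R e) * s%:R)^-1) ->
  solutions e X Y r theta ->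
  forall j, `|theta j 0 - theta0 j 0| <= c2 e alpha * r.
Proof.
move=> alpha1 s0 Js off sol j.
have c0_ge0 : 0 <= c0 R e by case: e {off sol}.
have kkt : forall j, `|corr theta j 0| <= r.
  by case: e sol {off c0_ge0}; [exact: lasso_kkt|exact: dantzig_feasible].
(* The response cancels in the difference of the two residual correlations, which are bounded by r /
   2 at [theta0] and by r at [theta]. *)
have PsiD k : `|(gram X *m (theta - theta0)) k 0| <= 3 / 2 * r.
  have -> : gram X *m (theta - theta0) = corr theta0 - corr theta.
    rewrite /gram /corr -scalerBr -mulmxBr -scalemxAl -mulmxA; congr (_ *: (_ *m _)).
    by rewrite mulmxBr opprB [RHS]addrC addrA subrK.
  have -> : (corr theta0 - corr theta) k 0 = corr theta0 k 0 - corr theta k 0.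
    by rewrite [LHS]mxE [X in _ + X = _]mxE.
  apply: le_trans (ler_normB _ _) _.
  by have := corr0 k; have := kkt k; lra.
have := coherence_sup_bound c0_ge0 alpha1 s0 Js gram1 off
  (solution_cone sol) PsiD j.
by rewrite !mxE /c2 mulrAC.
Qed.

End sup_error.

Lemma c2_gt0 (R : realType) e (alpha : R) : 1 < alpha -> 0 < c2 e alpha.
Proof.
move=> a1; rewrite /c2 mulr_gt0// ltr_pwDl// divr_ge0 ?sqr_ge0//.
rewrite mulr_ge0 ?subr_ge0 ?(ltW a1)//.
by case: e => /=; lra.
Qed.

(** Off the support |theta_j| <= t, so the coordinate is cut to 0. On it |theta_j| > 2 t - t = t,
    and an error of at most t cannot flip the sign. *)
Lemma threshold_sign (R : realType) m (theta theta0 : 'cV[R]_m) (t : R) :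
  0 <= t -> (forall j, `|theta j 0 - theta0 j 0| <= t) ->
  (forall j, j \in supp theta0 -> 2 * t < `|theta0 j 0|) ->
  sign_vec (threshold t theta) = sign_vec theta0.
Proof.
move=> t0 err strong; apply/colP => j; rewrite !mxE.
have := err j; have := strong j; rewrite inE ler_norml => H /andP[lo hi].
have [z|/H] := eqVneq (theta0 j 0) 0.
  rewrite z subr0 in lo hi; rewrite z.
  by rewrite ltNge ler_norml lo hi.
have [p|p] := ltP 0 (theta0 j 0).
  rewrite (gtr0_norm p) => tp.
  have q : 0 < theta j 0 by lra.
  rewrite gtr0_norm// ifT; last by lra.
  by rewrite !gtr0_sg.
rewrite (ler0_norm p) => tp.
have q : theta j 0 < 0 by lra.
rewrite ltr0_norm// ifT; last by lra.
by rewrite !ltr0_sg//; lra.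
Qed.

(** * Measurability of the recovery event *)

Definition coercive (R : realType) m (f : 'cV[R]_m -> R) :=
  forall N, exists B, forall theta, f theta <= N -> forall j, `|theta j 0| <= B.

Lemma coercive_le (R : realType) m (f g : 'cV[R]_m -> R) :
  (forall theta, f theta <= g theta) -> coercive f -> coercive g.
Proof.
move=> fg fc N; have [B fB] := fc N; exists B => theta gN.
exact/fB/(le_trans (fg theta)).
Qed.

Lemma coercive_subr (R : realType) m (f : 'cV[R]_m -> R) (c : R) :
  coercive f -> coercive (fun theta => f theta - c).
Proof.
move=> fc N; have [B fB] := fc (N + c); exists B => theta.
by rewrite lerBlDr; exact: fB.
Qed.

(** Carries the compactness of boxes of row vectors, [rV_compact], over to column vectors. *)
Lemma trmx_continuous (R : realType) m :
  continuous (fun v : 'rV[R]_m => v^T : 'cV[R]_m).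
Proof.
move=> M s /= /nbhs_ballP[e e0 es]; apply/nbhs_ballP; exists e => // N [_ MN].
by apply: es; split=> // i j; rewrite !mxE; exact: MN.
Qed.

Lemma box_compact (R : realType) m (B : R) :
  compact [set theta : 'cV[R]_m | forall j, `|theta j 0| <= B].
Proof.
have -> : [set theta : 'cV[R]_m | forall j, `|theta j 0| <= B] =
    (fun v : 'rV[R]_m => v^T : 'cV[R]_m) @`
      [set v : 'rV[R]_m | forall j, `[- B, B]%classic (v ord0 j)].
  apply/seteqP; split=> [theta /= H|_ [v /= H <-] j].
    exists theta^T; last by rewrite trmxK.
    by move=> j; rewrite mxE /= in_itv/= -ler_norml.
  by have := H j; rewrite mxE /= in_itv/= -ler_norml.
apply: continuous_compact.
  by apply: continuous_subspaceT; exact: trmx_continuous.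
apply: (@rV_compact _ _ (fun=> `[- B, B]%classic)) => _.
exact: segment_compact.
Qed.

Lemma closed_sublevel (R : realType) m (f : 'cV[R]_m -> R) (c : R) :
  continuous f -> closed [set theta | f theta <= c].
Proof.
move=> cf; rewrite (_ : mkset _ = f @^-1` [set y | y <= c])//.
by apply: preimage_closed; [move=> ? _; exact: cf|exact: closed_le].
Qed.

Lemma coercive_min (R : realType) m (f : 'cV[R]_m -> R) (C : set 'cV[R]_m) :
  continuous f -> coercive f -> closed C -> C !=set0 ->
  exists2 theta0, C theta0 & forall theta, C theta -> f theta0 <= f theta.
Proof.
move=> cf fc cC [t1 Ct1]; have [B fB] := fc (f t1).
pose K := [set theta : 'cV[R]_m | forall j, `|theta j 0| <= B] `&`
  (C `&` [set theta | f theta <= f t1]).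
have cK : compact K.
  apply: compact_closedI; first exact: box_compact.
  by apply: closedI => //; exact: closed_sublevel.
have K1 : K t1 by split; [exact: fB|split => /=].
have [t0 /set_mem[_ [Ct0 ft0]] t0min] : exists2 c, c \in K &
    forall t, t \in K -> f c <= f t.
  by apply: compact_EVT_min => //; [exists t1|exact: continuous_subspaceT].
exists t0 => // t Ct; have [ft|ft] := leP (f t) (f t1); last first.
  exact: le_trans (ltW ft).
by apply: t0min; apply/mem_set; split; [exact: fB|split].
Qed.

Lemma rat_cV_dense (R : realType) m (f : 'cV[R]_m -> R) theta (c : R) :
  {for theta, continuous f} -> f theta < c ->
  exists q : 'cV[rat]_m, f (map_mx ratr q) < c.
Proof.
move=> cf fc.
have /cf /= : nbhs (f theta) [set y | y < c].
  by apply: open_nbhs_nbhs; split => //; exact: open_lt.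
move=> /nbhs_ballP[eps /= e0 es].
have /choice[q qP] j : exists q : rat, ratr q \in `]theta j 0, (theta j 0 + eps)[.
  by apply: rat_in_itvoo; rewrite ltrDl.
exists (\col_j q j); apply: es; split => // i j.
rewrite !mxE ord1 /ball/= ltr_norml.
have := qP i; rewrite in_itv/= => /andP[lo hi].
by apply/andP; split; lra.
Qed.

(** A continuous coercive function attains its infimum, so it is nonpositive somewhere iff, for
    every k, some rational point has value at most 1 / (k + 1). Only countable operations remain. *)
Lemma measurable_exists_le0 d (T : measurableType d) (R : realType) m
    (g : T -> 'cV[R]_m -> R) :
  (forall theta, measurable_fun setT (g^~ theta)) ->
  (forall w, continuous (g w)) -> (forall w, coercive (g w)) ->
  measurable [set w | exists theta, g w theta <= 0].
Proof.
move=> mg cg gc.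
have -> : [set w | exists theta, g w theta <= 0] =
    \bigcap_(k : nat) \bigcup_(q : 'cV[rat]_m)
      [set w | g w (map_mx ratr q) <= k.+1%:R^-1].
  apply/seteqP; split=> [w [theta g0] k _|w H].
    have [|q qk] := @rat_cV_dense _ _ (g w) theta k.+1%:R^-1 (cg w theta).
      by apply: le_lt_trans g0 _; rewrite invr_gt0.
    by exists q => //=; exact: ltW.
  have [|t0 _ t0min] := @coercive_min _ _ (g w) setT (cg w) (gc w) closedT.
    by exists 0.
  exists t0; rewrite leNgt; apply/negP => gt0.
  (* This k makes 1 / (k + 1) smaller than the supposedly positive minimum. *)
  have [q _ /= qk] := H (Num.truncn (g w t0)^-1) I.
  have := t0min (map_mx ratr q) I; rewrite leNgt => /negP; apply.
  apply: le_lt_trans qk _; rewrite invf_plt ?posrE//.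
  exact: truncnS_gt.
apply: bigcapT_measurable => k; apply: countable_bigcupT_measurable.
  exact: countableP.
by move=> q; apply: measurable_set_le.
Qed.

(* By compactness, some minimizer over [phi <= 0] satisfies [h <= 0] iff every
   rational level reached by [f] on [phi <= 0] is also reached on
   [phi <= 0] intersected with [h <= 0]. *)
Lemma measurable_exists_minimizer d (T : measurableType d) (R : realType) m
    (phi f : T -> 'cV[R]_m -> R) (h : 'cV[R]_m -> R) :
  (forall theta, measurable_fun setT (phi^~ theta)) ->
  (forall theta, measurable_fun setT (f^~ theta)) ->
  (forall w, continuous (phi w)) -> (forall w, continuous (f w)) ->
  continuous h -> (forall w, coercive (f w)) ->
  measurable [set w | exists2 theta,
    minimizers [set t | phi w t <= 0] (f w) theta & h theta <= 0].
Proof.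
move=> mphi mf cphi cf ch fc.
(* Nonpositivity of [u1 q] means phi <= 0 and f <= q; [u2 q] adds h <= 0. Taking maxima keeps
   continuity, and coercivity is inherited from [f]. *)
pose u1 (q : R) w theta := Num.max (phi w theta) (f w theta - q).
pose u2 (q : R) w theta := Num.max (h theta) (u1 q w theta).
have cfq q w : continuous (fun theta => f w theta - q).
  by move=> theta; apply: continuousB; [exact: cf|exact: cst_continuous].
have cu1 q w : continuous (u1 q w).
  move=> theta; apply: (@continuous_max R _ (phi w) (fun t => f w t - q)).
    exact: cphi.
  exact: cfq.
have cu2 q w : continuous (u2 q w).
  move=> theta; apply: (@continuous_max R _ h (u1 q w)); first exact: ch.
  exact: cu1.
have mu1 q theta : measurable_fun setT (fun w => u1 q w theta).
  by apply: measurable_maxr => //; exact: measurable_funB.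
have mu2 q theta : measurable_fun setT (fun w => u2 q w theta).
  exact: measurable_maxr.
have u1c q w : coercive (u1 q w).
  apply: (@coercive_le _ _ (fun theta => f w theta - q)); last exact: coercive_subr.
  by move=> theta; rewrite /u1 le_max lexx orbT.
have u2c q w : coercive (u2 q w).
  apply: (@coercive_le _ _ (u1 q w)) => // theta.
  by rewrite /u2 le_max lexx orbT.
pose E (u : T -> 'cV[R]_m -> R) := [set w : T | exists theta : 'cV[R]_m, u w theta <= 0].
have mE1 q : measurable (E (u1 q)) by exact: measurable_exists_le0.
have mE2 q : measurable (E (u2 q)) by exact: measurable_exists_le0.
have -> : [set w | exists2 theta,
    minimizers [set t | phi w t <= 0] (f w) theta & h theta <= 0] =
    \bigcup_(q : rat) E (u2 (ratr q)) `&`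
    \bigcap_(q : rat) (~` E (u1 (ratr q)) `|` E (u2 (ratr q))).
  apply/seteqP; split=> [w [theta [/= phi0 opt] h0]|w [[q0 _ [t1 t1P]] H]].
    split.
      have [|q] := @rat_in_itvoo R (f w theta) (f w theta + 1).
        by rewrite ltrDl.
      rewrite in_itv/= => /andP[fq _]; exists q => //; exists theta.
      by rewrite /u2 /u1 !ge_max h0 phi0/= subr_le0 ltW.
    move=> q _ /=; have [[t]|] := pselect (E (u1 (ratr q)) w); last by left.
    rewrite /u1 ge_max => /andP[phit ft]; right; exists theta.
    rewrite /u2 /u1 !ge_max h0 phi0/= subr_le0; apply: le_trans (opt t phit) _.
    by rewrite -subr_le0.
  (* The union over rational levels ensures that the set phi <= 0, h <= 0 is nonempty, so [f] has a
     minimizer on it. *)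
  have CP t : u2 (ratr q0) w t <= 0 -> ([set t | phi w t <= 0] `&` [set t | h t <= 0]) t.
    by rewrite /u2 /u1 !ge_max => /and3P[].
  have [||t0 [phi0 h0] t0min] := coercive_min (cf w) (fc w)
      (C := [set t | phi w t <= 0] `&` [set t | h t <= 0]).
  - by apply: closedI; exact: closed_sublevel.
  - by exists t1; exact: CP t1P.
  exists t0 => //; split => // t /= phit; rewrite leNgt; apply/negP => ft.
  (* If a feasible t did better than [t0], a rational level strictly between their values would be
     reached under phi <= 0 but not with h <= 0 added. *)
  have [q] := rat_in_itvoo ft; rewrite in_itv/= => /andP[tq qt].
  case: (H q I) => [[]|[t2]].
    by exists t; rewrite /u1 ge_max phit/= subr_le0 ltW.
  rewrite /u2 /u1 !ge_max => /and3P[h2 phi2]; rewrite subr_le0 => f2.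
  have := t0min t2 (conj phi2 h2).
  by rewrite leNgt (le_lt_trans f2 qt).
apply: measurableI; first by apply: bigcupT_measurable_rat => q; exact: mE2.
rewrite -[X in measurable X]setCK setC_bigcap; apply: measurableC.
apply: bigcupT_measurable_rat => q; apply: measurableC; apply: measurableU => //.
exact: measurableC.
Qed.

(** * Application to the Lasso and Dantzig solution sets *)

Section solutions_measurable.
Context (R : realType) (n m : nat) (X : 'M[R]_(n, m)).

Definition criterion (e : estimator) (r : R) (y : 'cV[R]_n)
    (theta : 'cV[R]_m) : R :=
  match e with
  | Lasso => n%:R^-1 * (\sum_i (y i 0 - \sum_k X i k * theta k 0) ^+ 2)
      + 2 * r * \sum_j `|theta j 0|
  | Dantzig => \sum_j `|theta j 0|
  end.

(** The sup-norm constraint as one inequality between continuous functions: a sum of positive parts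
    is nonpositive iff no correlation exceeds r. The Lasso is unconstrained. *)
Definition infeasibility (e : estimator) (r : R) (y : 'cV[R]_n)
    (theta : 'cV[R]_m) : R :=
  match e with
  | Lasso => 0
  | Dantzig => \sum_j Num.max
      (`|n%:R^-1 * \sum_i X i j * (y i 0 - \sum_k X i k * theta k 0)| - r) 0
  end.

Lemma residualE (y : 'cV[R]_n) (theta : 'cV[R]_m) i :
  (y - X *m theta) i 0 = y i 0 - \sum_k X i k * theta k 0.
Proof. by rewrite !mxE. Qed.

Lemma criterionE e r y :
  criterion e r y = match e with
  | Lasso => fun theta =>
      n%:R^-1 * lpnorm 2 (y - X *m theta) ^+ 2 + 2 * r * lpnorm 1 theta
  | Dantzig => lpnorm 1
  end.
Proof.
case: e; apply/funext => theta /=; last by rewrite lpnorm1E.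
rewrite lpnorm2E lpnorm1E; congr (_ * _ + _).
by apply: eq_bigr => i _; rewrite residualE.
Qed.

Lemma solutionsE e r (y : 'cV[R]_n) : 0 <= r ->
  solutions e X y r =
  minimizers [set theta | infeasibility e r y theta <= 0] (criterion e r y).
Proof.
move=> r0; rewrite criterionE; case: e => /=.
  by congr (minimizers _ _); apply/seteqP; split=> t _ /=.
congr (minimizers _ _); apply/seteqP; split=> theta /=.
  move=> /(cV_norm_le _ r0) H; rewrite big1// => j _.
  apply/max_idPr; rewrite subr_le0; apply: le_trans (H j).
  rewrite !mxE; under [in X in _ <= X]eq_bigr do rewrite residualE mxE.
  exact: lexx.
move=> H; apply/(cV_norm_le _ r0) => j.
rewrite !mxE; under eq_bigr do rewrite residualE mxE.
rewrite -subr_le0; apply: le_trans H; rewrite (bigD1 j)//=.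
rewrite -[leLHS]addr0; apply: lerD; first by rewrite le_max lexx.
by apply: sumr_ge0 => k _; rewrite le_max lexx orbT.
Qed.

Lemma continuous_sum (S : topologicalType) (I : Type) (s : seq I)
    (F : I -> S -> R) :
  (forall i, continuous (F i)) -> continuous (fun x => \sum_(i <- s) F i x).
Proof.
by move=> cF; apply: continuous_big => //; exact: add_continuous.
Qed.

Lemma continuous_scale (S : topologicalType) (c : R) (f : S -> R) :
  continuous f -> continuous (fun x => c * f x).
Proof.
by move=> cf x; exact: (continuousM (@cst_continuous S R c x) (cf x)).
Qed.

Lemma coord_norm_continuous j : continuous (fun theta : 'cV[R]_m => `|theta j 0|).
Proof.
move=> theta.
apply: (@continuous_comp _ _ _ (fun t : 'cV[R]_m => t j 0) (fun x : R => `|x|)).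
  exact: coord_continuous.
exact: norm_continuous.
Qed.

Lemma residual_continuous (y : 'cV[R]_n) i :
  continuous (fun theta : 'cV[R]_m => y i 0 - \sum_k X i k * theta k 0).
Proof.
move=> theta; apply: continuousB; first exact: cst_continuous.
apply: continuous_sum => k t.
by apply: continuousM; [exact: cst_continuous|exact: coord_continuous].
Qed.

Lemma criterion_continuous e r y : continuous (criterion e r y).
Proof.
have c1 : continuous (fun theta : 'cV[R]_m => \sum_j `|theta j 0|).
  by apply: continuous_sum => j; exact: coord_norm_continuous.
case: e; rewrite /criterion // => theta.
have c2 : continuous (fun t : 'cV[R]_m =>
    n%:R^-1 * \sum_i (y i 0 - \sum_k X i k * t k 0) ^+ 2).
  apply: continuous_scale.
  apply: continuous_sum => i v.
  exact: (continuousM (@residual_continuous y i v) (@residual_continuous y i v)).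
have c3 : continuous (fun t : 'cV[R]_m => 2 * r * \sum_j `|t j 0|).
  exact: continuous_scale.
exact: (continuousD (c2 theta) (c3 theta)).
Qed.

Lemma infeasibility_continuous e r y : continuous (infeasibility e r y).
Proof.
case: e; rewrite /infeasibility => theta; first exact: cst_continuous.
have corr_continuous j : continuous (fun t : 'cV[R]_m =>
    n%:R^-1 * \sum_i X i j * (y i 0 - \sum_k X i k * t k 0)).
  apply: continuous_scale; apply: continuous_sum => i.
  exact/continuous_scale/residual_continuous.
have excess_continuous j : continuous (fun t : 'cV[R]_m =>
    `|n%:R^-1 * \sum_i X i j * (y i 0 - \sum_k X i k * t k 0)| - r).
  move=> t; apply: (continuousB _ (@cst_continuous _ R r t)).
  by apply: (continuous_comp (corr_continuous j t)); exact: norm_continuous.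
apply: continuous_sum => j t.
exact: (continuous_max (excess_continuous j t) (@cst_continuous _ R 0 t)).
Qed.

Lemma l1_coercive : coercive (fun theta : 'cV[R]_m => \sum_j `|theta j 0|).
Proof.
move=> N; exists N => theta H j; apply: le_trans H.
by rewrite (bigD1 j)//= lerDl sumr_ge0.
Qed.

Lemma criterion_coercive e r y : 0 < r -> coercive (criterion e r y).
Proof.
move=> r0; case: e => /=; last exact: l1_coercive.
move=> N; have [B HB] := l1_coercive (N / (2 * r)); exists B => theta H.
apply: HB; rewrite ler_pdivlMr ?mulr_gt0// mulrC; apply: le_trans H.
by rewrite lerDr mulr_ge0// ?invr_ge0// sumr_ge0// => i _; exact: sqr_ge0.
Qed.

Context d (T : measurableType d) (y : T -> 'cV[R]_n).
Hypothesis my : forall i, measurable_fun setT (fun w => y w i 0).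

Lemma measurable_residual i (theta : 'cV[R]_m) :
  measurable_fun setT (fun w => y w i 0 - \sum_k X i k * theta k 0).
Proof. exact: measurable_funB. Qed.

Lemma measurable_criterion e r theta :
  measurable_fun setT (fun w => criterion e r (y w) theta).
Proof.
case: e => //=; apply: measurable_funD => //; apply: measurable_funM => //.
apply: measurable_sum => i; apply: measurable_funX; exact: measurable_residual.
Qed.

Lemma measurable_infeasibility e r theta :
  measurable_fun setT (fun w => infeasibility e r (y w) theta).
Proof.
case: e => //=; apply: measurable_sum => j.
apply: measurable_maxr => //; apply: measurable_funB => //.
apply: (measurableT_comp (@normr_measurable R setT)).
apply: measurable_funM => //; apply: measurable_sum => i.
by apply: measurable_funM => //; exact: measurable_residual.
Qed.

Lemma measurable_sign_recovery e r t (theta0 : 'cV[R]_m) : 0 < r -> 0 <= t ->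
  measurable [set w | forall theta,
    (threshold t @` solutions e X (y w) r) theta ->
    sign_vec theta = sign_vec theta0].
Proof.
move=> r0 t0.
(* [defect j k] is nonpositive for some [k] exactly when the thresholded
   coordinate has the wrong sign. *)
pose defect j (k : nat) (theta : 'cV[R]_m) : R :=
  if theta0 j 0 == 0 then t + k.+1%:R^-1 - `|theta j 0|
  else if 0 < theta0 j 0 then theta j 0 - t else - t - theta j 0.
have cdefect j k : continuous (defect j k).
  have cst_cont c u : {for u, continuous (fun _ : 'cV[R]_m => c : R)}.
    exact: cst_continuous.
  have coord_cont u : {for u, continuous (fun t : 'cV[R]_m => t j 0)}.
    exact: coord_continuous.
  move=> theta; rewrite /defect; case: (theta0 j 0 == 0).
    exact: (continuousB (cst_cont _ _) (@coord_norm_continuous j theta)).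
  by case: (0 < theta0 j 0); [exact: (continuousB (coord_cont _) (cst_cont t _))|
    exact: (continuousB (cst_cont (- t) _) (coord_cont _))].
(* Off the support, failure is the strict inequality |theta_j| > t, a union over k of the closed
   conditions |theta_j| >= t + 1 / (k + 1). On the support, failure is already closed because the
   threshold is strict. *)
have defectP j theta : Num.sg (threshold t theta j 0) <> Num.sg (theta0 j 0) <->
    exists k, defect j k theta <= 0.
  rewrite /defect /threshold mxE; set a := theta j 0.
  have [z|nz] := eqVneq (theta0 j 0) 0.
    rewrite z sgr0; case: ltP => ta.
      split=> [_|_]; last first.
        by move/eqP; rewrite sgr_eq0 => /eqP a0; move: ta; rewrite a0 normr0 ltNge t0.
      exists (Num.truncn (`|a| - t)^-1).
      have h : (Num.truncn (`|a| - t)^-1).+1%:R^-1 < `|a| - t.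
        by rewrite invf_plt ?posrE ?subr_gt0//; exact: truncnS_gt.
      by rewrite subr_le0 -lerBrDl ltW.
    rewrite sgr0; split=> // -[k].
    have : 0 < k.+1%:R^-1 :> R by rewrite invr_gt0.
    by move: (k.+1%:R^-1 : R) => x; lra.
  have [p|p] := ltP 0 (theta0 j 0).
    rewrite (gtr0_sg p); split=> [H|[_ at0]].
      exists 0%N; rewrite subr_le0 leNgt; apply/negP => ta; apply: H.
      by rewrite ifT ?gtr0_sg ?(le_lt_trans t0)// gtr0_norm// (le_lt_trans t0).
    case: ltP => ta; last by rewrite sgr0 => /esym/eqP; rewrite oner_eq0.
    have a0 : a <= 0.
      by rewrite leNgt; apply/negP => ap; move: ta; rewrite gtr0_norm//; lra.
    by move=> /eqP; rewrite sgr_cp0 ltNge a0.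
  have {}p : theta0 j 0 < 0 by rewrite lt_neqAle nz.
  rewrite (ltr0_sg p); split=> [H|[_ at0]].
    exists 0%N; rewrite leNgt; apply/negP => ta; apply: H.
    have a0 : a < 0 by lra.
    by rewrite ltr0_norm// ifT ?ltr0_sg//; lra.
  case: ltP => ta; last by rewrite sgr0 => /esym/eqP; rewrite oppr_eq0 oner_eq0.
  have a0 : 0 <= a.
    by rewrite leNgt; apply/negP => ap; move: ta; rewrite ltr0_norm//; lra.
  by move=> /eqP; rewrite sgr_cp0 ltNge a0.
pose bad j k := [set w | exists2 theta,
  minimizers [set u | infeasibility e r (y w) u <= 0] (criterion e r (y w)) theta
  & defect j k theta <= 0].
have -> : [set w | forall theta,
    (threshold t @` solutions e X (y w) r) theta ->
    sign_vec theta = sign_vec theta0] =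
    ~` \bigcup_(j : 'I_m) \bigcup_(k : nat) bad j k.
  apply/seteqP; split=> [w H [j _ [k _ [theta]]]|w H theta' [theta sol <-]].
    rewrite -solutionsE ?(ltW r0)// => sol dle.
    have : exists k, defect j k theta <= 0 by exists k.
    move=> /defectP; apply.
    have := H (threshold t theta) (ex_intro2 _ _ theta sol erefl).
    by move=> /matrixP/(_ j 0); rewrite !mxE.
  apply/colP => j; rewrite [LHS]mxE [RHS]mxE.
  apply/eqP/negP => /negP/eqP/defectP[k dk]; apply: H.
  exists j => //; exists k => //; exists theta => //.
  by rewrite -solutionsE ?(ltW r0).
apply: measurableC; apply: countable_bigcupT_measurable; first exact: countableP.
move=> j; apply: bigcupT_measurable => k; apply: measurable_exists_minimizer.
- by move=> theta; exact: measurable_infeasibility.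
- by move=> theta; exact: measurable_criterion.
- by move=> w; exact: infeasibility_continuous.
- by move=> w; exact: criterion_continuous.
- exact: cdefect.
- by move=> w; exact: criterion_coercive.
Qed.

End solutions_measurable.

(** * Probability of recovery *)

Lemma probability_bigcup_le d (T : measurableType d) (R : realType)
    (P : probability T R) (I : finType) (F : I -> set T) (c : R) :
  (forall i, measurable (F i)) -> (forall i, (P (F i) <= c%:E)%E) ->
  (P (\bigcup_i F i) <= (#|I|%:R * c)%:E)%E.
Proof.
move=> mF PF.
have aux (s : seq I) : measurable (\big[setU/set0]_(i <- s) F i) /\
    (P (\big[setU/set0]_(i <- s) F i) <= ((size s)%:R * c)%:E)%E.
  elim: s => [|i s [ms Ps]]; first by rewrite big_nil measure0 mul0r.
  rewrite big_cons; split; first exact: measurableU.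
  apply: (le_trans (measureU2 _ _ _)) => //.
  by rewrite /= -natr1 mulrDl mul1r addrC EFinD; exact: leeD.
have -> : \bigcup_i F i = \big[setU/set0]_(i <- enum I) F i.
  rewrite -bigcup_seq; congr bigcup.
  by apply/seteqP; split=> i /= _; rewrite ?mem_enum.
by have [_] := aux (enum I); rewrite -cardE.
Qed.

(** The bound for a single n: a union bound over the m coordinates of X^T W / n, followed by the
    deterministic estimate on the complement. *)
Lemma sign_recovery_probability d (T : measurableType d) (R : realType)
    (P : probability T R) (n m s : nat) (sigma alpha c1 r : R) (e : estimator)
    (X : 'M[R]_(n, m)) (theta0 : 'cV[R]_m) (W : 'I_n -> {RV P >-> R})
    (y : T -> 'cV[R]_n) :
  0 < sigma -> 1 < alpha -> 2 * c2 e alpha < c1 -> 0 < r ->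
  (0 < n)%N -> (0 < s)%N ->
  (forall w, y w = X *m theta0 + \col_i W i w) ->
  iid_centered_normal sigma W ->
  (forall j, gram X j j = 1) ->
  (forall i j, i != j ->
    `|gram X i j| <= (alpha * (1 + 2 * c0 R e) * s%:R)^-1) ->
  (#|supp theta0| <= s)%N ->
  (forall j, j \in supp theta0 -> c1 * r < `|theta0 j 0|) ->
  let recovery := [set w | forall theta,
    (threshold (c2 e alpha * r) @` solutions e X (y w) r) theta ->
    sign_vec theta = sign_vec theta0] in
  measurable recovery /\
  ((1 - m%:R * (2 * expR (- (n%:R * r ^+ 2 / (8 * sigma ^+ 2)))))%:E
    <= P recovery)%E.
Proof.
move=> sigma0 alpha1 c1P r0 n0 s0 yE iid diag off Js strong recovery.
have c20 : 0 < c2 e alpha by exact: c2_gt0.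
have mrec : measurable recovery.
  apply: measurable_sign_recovery => // [i|]; last by rewrite ltW// mulr_gt0.
  under eq_fun do rewrite yE mxE [X in _ + X]mxE.
  by apply: measurable_funD => //; exact: measurable_funP.
split => //.
pose F j := [set w | r / 2 <= `|\sum_i (n%:R^-1 * X i j) * W i w|].
have n0' : 0 < n%:R :> R by rewrite ltr0n.
have mF j : measurable (F j).
  apply: (@measurable_set_le _ T R (cst (r / 2))) => //.
  apply: (measurableT_comp (@normr_measurable R setT)).
  exact: measurable_gaussian_sum.
(* Each coordinate of X^T W / n has variance sigma^2 / n, so the tail at r / 2 has exponent - n r^2
   / (8 sigma^2). *)
have sq j : \sum_i (n%:R^-1 * X i j) ^+ 2 = n%:R^-1.
  have := diag j; rewrite gramE => H.
  under eq_bigr do rewrite expr2 mulrACA -mulrA.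
  by rewrite -mulr_sumr -mulr_sumr H mulr1.
have PF j : (P (F j) <=
    (2 * expR (- (n%:R * r ^+ 2 / (8 * sigma ^+ 2))))%:E)%E.
  have := @gaussian_sum_tail _ _ _ P _ sigma W (lt0r_neq0 sigma0) iid
    (fun i => n%:R^-1 * X i j) (r / 2).
  rewrite sq => /(_ (divr_gt0 r0 (ltr0Sn _ 1))).
  rewrite invr_gt0 => /(_ n0').
  set u := - _; set v := - _; have -> // : u = v.
  rewrite /u /v; field.
  by rewrite !gt_eqF.
have mU : measurable (\bigcup_j F j).
  by apply: countable_bigcupT_measurable; first exact: countableP.
have sub : ~` (\bigcup_j F j) `<=` recovery.
  move=> w /= nF _ [theta sol <-]; apply: threshold_sign.
  - by rewrite ltW// mulr_gt0.
  - rewrite yE in sol => j.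
    apply: (solution_sup_error n0 r0 diag _ alpha1 s0 Js off sol) => k.
    rewrite leNgt; apply/negP => H; apply: nF; exists k => //=.
    apply: le_trans (ltW H) _; rewrite mulr_sumr le_eqVlt; apply/orP; left.
    by apply/eqP; congr `|_|; apply: eq_bigr => i _; rewrite mxE mulrA.
  - move=> j /strong; apply: le_lt_trans.
    by rewrite mulrA ler_wpM2r// ltW.
apply: (@le_trans _ _ (P (~` (\bigcup_j F j)))); last first.
  by apply: le_measure => //; rewrite inE//; exact: measurableC.
rewrite probability_setC// EFinB; apply: leeB => //.
by have := @probability_bigcup_le _ _ _ P _ F _ mF PF; rewrite card_ord.
Qed.

Theorem corollary1 (R : realType) (sigma A alpha c1 : R) (e : estimator)
    (sigma_gt0 : 0 < sigma) (A_gt : 2 * Num.sqrt 2 < A) (alpha_gt1 : 1 < alpha)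
    (c1_gt : 2 * c2 e alpha < c1)
    (M s : nat -> nat)
    (M_ge2 : forall n : nat, (1 <= n)%N -> (2 <= M n)%N)
    (s_ge1 : forall n : nat, (1 <= n)%N -> (1 <= s n)%N)
    (X : forall n : nat, 'M[R]_(n, M n))
    (theta_star : forall n : nat, 'cV[R]_(M n))
    (d : nat -> measure_display)
    (T : forall n : nat, measurableType (d n))
    (P : forall n : nat, probability (T n) R)
    (W : forall n : nat, 'I_n -> {RV (P n) >-> R})
    (Y : forall n : nat, T n -> 'cV[R]_n)
    (Y_def : forall (n : nat) (w : T n),
      Y n w = X n *m theta_star n + \col_(i < n) W n i w)
    (r : nat -> R)
    (r_def : forall n : nat, r n = tuning A sigma n (M n))
    (noise_iid : \forall n \near \oo, iid_centered_normal sigma (W n))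
    (gram_diag : \forall n \near \oo, forall j : 'I_(M n),
      gram (X n) j j = 1)
    (gram_offdiag : \forall n \near \oo, forall i j : 'I_(M n), i != j ->
      `|gram (X n) i j| <= (alpha * (1 + 2 * c0 R e) * (s n)%:R)^-1)
    (sparse : \forall n \near \oo, (#|supp (theta_star n)| <= s n)%N)
    (strong_signal : \forall n \near \oo, forall j : 'I_(M n),
      j \in supp (theta_star n) -> c1 * r n < `|theta_star n j 0|)
    (M_infty : M n @[n --> \oo] --> \oo)
    (logM_o_n : (ln (M n)%:R / n%:R : R) @[n --> \oo] --> (0 : R)) :
  P n [set w | forall theta : 'cV[R]_(M n),
        (threshold (c2 e alpha * r n) @` solutions e (X n) (Y n w) (r n)) theta ->
        sign_vec theta = sign_vec (theta_star n)]
    @[n --> \oo] --> 1%E.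
Proof.
have sqrt2 : 0 < Num.sqrt 2 :> R by rewrite sqrtr_gt0.
have A0 : 0 < A by apply: lt_trans A_gt; rewrite mulr_gt0.
have A8 : 8 < A ^+ 2.
  have -> : 8 = (2 * Num.sqrt 2) ^+ 2 :> R.
    by rewrite exprMn sqr_sqrtr//; ring.
  by rewrite ltr_pXn2r// nnegrE ?ltW// mulr_gt0.
(* By the choice of r, n r^2 / (8 sigma^2) = (A^2 / 8) log M, so the failure bound is 2 M^(-
   delta). *)
pose delta := A ^+ 2 / 8 - 1.
have delta0 : 0 < delta by rewrite /delta; lra.
pose L n : R := ln (M n)%:R.
have Loo : (delta * L n) @[n --> \oo] --> +oo.
  apply/cvgryPge => B.
  (* Once M >= exp(B / delta), delta log M >= B. *)
  have /cvgrnyP/cvgryPge/(_ (expR (B / delta))) := M_infty; apply: filterS.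
  move=> n MB; rewrite mulrC -ler_pdivrMr// -[leLHS]expRK ler_ln// posrE ?expR_gt0//.
  exact: lt_le_trans (expR_gt0 _) MB.
have eps0 : (1 - 2 * expR (- (delta * L n)))%:E @[n --> \oo] --> 1%E.
  apply/fine_cvgP; split; first by near=> n.
  rewrite -[X in _ --> X]subr0; apply: cvgB; first exact: cvg_cst.
  rewrite -[X in _ --> X](mulr0 2); apply: cvgM; first exact: cvg_cst.
  exact: (cvg_comp _ _ Loo (@cvgr_expR R)).
apply: (squeeze_cvge _ eps0 (cvg_cst _)).
near=> n.
have n0 : (0 < n)%N by near: n; exact: nbhs_infty_gt.
have M2 := M_ge2 n n0.
have L0 : 0 < L n by rewrite ln_gt0// ltr1n.
have Ln0 : 0 < ln (M n)%:R / n%:R :> R by rewrite divr_gt0// ltr0n.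
have r0 : 0 < r n.
  by rewrite r_def /tuning !mulr_gt0// sqrtr_gt0.
have [] := @sign_recovery_probability _ _ _ (P n) n (M n) (s n) sigma alpha c1
  (r n) e (X n) (theta_star n) (W n) (Y n) sigma_gt0 alpha_gt1 c1_gt r0 n0
  (s_ge1 n n0) (Y_def n).
- by near: n.
- by near: n.
- by near: n.
- by near: n.
- by near: n.
move=> mG PG; rewrite probability_le1// andbT.
apply: le_trans PG; rewrite lee_fin lerD2l lerN2 le_eqVlt; apply/orP; left.
apply/eqP; rewrite [LHS]mulrCA; congr (2 * _).
(* The union-bound factor M is written as exp(log M) and merged into the exponent. *)
rewrite -[X in X * _](@lnK _ (M n)%:R) ?posrE ?ltr0n; last exact: leq_trans M2.
rewrite -expRD; congr expR; rewrite -/(L n) r_def /tuning !exprMn sqr_sqrtr; last first.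
  exact: ltW.
rewrite -/(L n) /delta; field.
by rewrite !gt_eqF// ltr0n.
Unshelve. all: by end_near.
Qed.
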